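(* Let $R$ be a commutative ring with nonzero identity and let $\phi:M\to N$ be a homomorphism of $R$-modules. Then: (i) If $M$ is a pseudo simple $R$-module and $\phi$ is surjective, then $N$ is a pseudo simple $R$-module. (ii) If $N$ is a pseudo simple $R$-module and $\phi$ is injective, then $M$ is a pseudo simple $R$-module.
   Context: For a commutative ring $R$ with nonzero identity (not necessarily a domain), an $R$-module $M$ is called pseudo simple if the submodule $Rm$ is simple for every $0\neq m\in M$ with $Rm\neq M$. *)

(* Defs.v *)
From mathcomp Require Import all_boot all_order all_algebra.
From mathcomp Require Import all_classical.

Set Implicit Arguments.
Unset Strict Implicit.
Unset Printing Implicit Defensive.

Import GRing.Theory.

Local Open Scope classical_set_scope.
Local Open Scope ring_scope.

(* A submodule is a classical set, turned into a collective predicate by [mem]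
   so that the library's closure property applies to it. *)
Definition submodule (R : comNzRingType) (M : lmodType R) (A : set M) : Prop :=
  GRing.submod_closed (mem A).

Definition cyclic_submodule (R : comNzRingType) (M : lmodType R) (m : M) :
    set M :=
  range (fun a : R => a *: m).

(* Simplicity of a submodule [A], regarded as a module: the submodules of [A]
   are the submodules of [M] contained in [A]. *)
Definition simple_submodule (R : comNzRingType) (M : lmodType R)
    (A : set M) : Prop :=
  [/\ submodule A,
      A <> [set 0] &
      forall B : set M, submodule B -> B `<=` A -> B = [set 0] \/ B = A].

Definition pseudo_simple (R : comNzRingType) (M : lmodType R) : Prop :=
  forall m : M, m <> 0 -> cyclic_submodule m <> [set: M] ->
    simple_submodule (cyclic_submodule m).

(* Main.v *)
(** For [m <> 0], the module [R m] is simple iff every nonzero [a m] generates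
    it, that is iff [m = b a m] for some [b].  This condition is
    transported by linear maps forwards, and backwards by injective ones. *)

Require Import Defs.
From mathcomp Require Import all_boot all_order all_algebra.
From mathcomp Require Import all_classical.

Set Implicit Arguments.
Unset Strict Implicit.
Unset Printing Implicit Defensive.

Import GRing.Theory.

Local Open Scope classical_set_scope.
Local Open Scope ring_scope.

(** Trades the boolean membership of [mem A] for plain set membership, so that later proofs need not
    convert. *)
Lemma submoduleP (R : comNzRingType) (M : lmodType R) (A : set M) :
  submodule A <->
  A 0 /\ forall (a : R) (u v : M), A u -> A v -> A (a *: u + v).
Proof.
split=> [[A0 Alin]|[A0 Alin]]; split=> [|a u v Au Av].
- exact: set_mem A0.
- by apply: set_mem; apply: Alin; apply: mem_set.
- exact: mem_set A0.
- by apply: mem_set; apply: Alin; apply: set_mem.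
Qed.

Lemma submodule_scale (R : comNzRingType) (M : lmodType R) (A : set M)
    (a : R) (u : M) : submodule A -> A u -> A (a *: u).
Proof. by case/submoduleP=> A0 Alin Au; rewrite -[_ *: _]addr0; apply: Alin. Qed.

Lemma cyclic_submoduleP (R : comNzRingType) (M : lmodType R) (m : M) :
  submodule (cyclic_submodule m).
Proof.
apply/submoduleP; split=> [|a _ _ [b _ <-] [c _ <-]].
  by exists 0; rewrite ?scale0r.
by exists (a * b + c); rewrite // scalerDl scalerA.
Qed.

Lemma mem_cyclic_submodule (R : comNzRingType) (M : lmodType R) (m : M) :
  cyclic_submodule m m.
Proof. by exists 1; rewrite ?scale1r. Qed.

Lemma cyclic_submodule_sub (R : comNzRingType) (M : lmodType R) (A : set M)
    (m : M) : submodule A -> A m -> cyclic_submodule m `<=` A.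
Proof. by move=> sA Am _ [a _ <-]; apply: submodule_scale. Qed.

Lemma simple_cyclicP (R : comNzRingType) (M : lmodType R) (m : M) :
  m <> 0 ->
  simple_submodule (cyclic_submodule m) <->
  forall a : R, a *: m <> 0 -> exists b : R, b *: (a *: m) = m.
Proof.
move=> m0; split=> [[_ _ simp] a am0|gen].
  have sub : cyclic_submodule (a *: m) `<=` cyclic_submodule m.
    by apply: cyclic_submodule_sub; [apply: cyclic_submoduleP | exists a].
  (* The submodule generated by [a *: m] contains [a *: m], which is nonzero, so only equality with
     [cyclic_submodule m] survives; then [m] itself is a multiple of [a *: m]. *)
  have [Eam|Eam] := simp _ (cyclic_submoduleP _) sub.
    by have := mem_cyclic_submodule (a *: m); rewrite Eam.
  by have := mem_cyclic_submodule m; rewrite -Eam => -[b _ bam]; exists b.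
split; first exact: cyclic_submoduleP.
  by move=> Em; have := mem_cyclic_submodule m; rewrite Em.
move=> B sB BRm; have [B0|] := pselect (B `<=` [set 0]).
  left; apply/seteqP; split=> // _ ->.
  by case/submoduleP: sB.
move=> /existsNP[u /not_implyP[Bu u0]]; right; apply/seteqP; split=> //.
(* The nonzero [u] in [B] is some [a *: m]; the hypothesis [gen] recovers [m] from it, so [m] lies
   in [B]. *)
have [a _ Eu] := BRm _ Bu; rewrite -Eu in Bu u0.
have [b bam] := gen a u0.
by apply: cyclic_submodule_sub => //; rewrite -bam; apply: submodule_scale.
Qed.

(** Serves to compare the conditions that [m] does not generate [M] and that [phi m] does not
    generate [N]. *)
Lemma linear_image_cyclic (R : comNzRingType) (M N : lmodType R)
    (phi : {linear M -> N}) (m : M) :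
  phi @` cyclic_submodule m = cyclic_submodule (phi m).
Proof.
rewrite /cyclic_submodule image_comp; congr (_ @` _).
by apply/funext => a /=; rewrite linearZZ.
Qed.

Theorem theorem6 (R : comNzRingType) (M N : lmodType R)
    (phi : {linear M -> N}) :
  (pseudo_simple M -> set_surj [set: M] [set: N] phi -> pseudo_simple N) /\
  (pseudo_simple N -> injective phi -> pseudo_simple M).
Proof.
split=> [psM surj n|psN inj m m0 RmT].
  have [m _ <-] := surj n I; move=> n0 RnT.
  have m0 : m <> 0 by move=> Em; apply: n0; rewrite Em linear0.
  have RmT : cyclic_submodule m <> [set: M].
    (* If [m] generated [M], its image would generate the image of [phi], which is all of [N] by
       surjectivity. *)
    move=> Em; apply: RnT; rewrite -linear_image_cyclic Em.
    by apply/seteqP; split=> // x _; apply: surj.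
  have /(simple_cyclicP m0) gen := psM m m0 RmT.
  apply/simple_cyclicP => // a an0.
  have [|b bam] := gen a.
    by move=> am0; apply: an0; rewrite -(linearZZ phi) am0 linear0.
  by exists b; rewrite -[in RHS]bam !(linearZZ phi).
have n0 : phi m <> 0 by move=> Em; apply: m0; apply: inj; rewrite Em linear0.
have RnT : cyclic_submodule (phi m) <> [set: N].
  (* If [phi m] generated [N], every [phi x] would equal [phi y] with [y] a multiple of [m], and
     injectivity would give [x = y]. *)
  rewrite -linear_image_cyclic => En; apply: RmT.
  apply/seteqP; split=> // x _.
  have : [set: N] (phi x) by [].
  by rewrite -En => -[y Ry /inj <-].
have /(simple_cyclicP n0) gen := psN _ n0 RnT.
apply/simple_cyclicP => // a am0.
(* Injectivity enters twice: it keeps [a *: phi m] nonzero, and it pulls the resulting equation in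
   [N] back to [M]. *)
have [|b ban] := gen a.
  by rewrite -(linearZZ phi) => E0; apply: am0; apply: inj; rewrite E0 linear0.
by exists b; apply: inj; rewrite !(linearZZ phi).
Qed.
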